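(* Let $D\subseteq W$ be a maximal Condorcet domain. Then $D$ is connected if and only if $D$ is peak-pit.
   Context: Let $\Phi$ be a finite root system in a real Euclidean space (a finite set of nonzero vectors with $\Phi\cap\mathbb{R}\alpha=\{\alpha,-\alpha\}$ and $s_\alpha(\Phi)=\Phi$ for all $\alpha\in\Phi$, where $s_\alpha$ is the orthogonal reflection in $\alpha^\perp$; not necessarily crystallographic). Let $\Phi^+$ be a choice of positive roots, $\Phi^-=\Phi\setminus\Phi^+$, and let $W=W(\Phi)$ be the finite Coxeter group generated by the $s_\alpha$. For $w\in W$, the (left) inversion set is $I(w):=\{\alpha\in\Phi\mid w^{-1}\alpha\in\Phi^-\}$ (negative roots are allowed, so exactly one of $\alpha,-\alpha$ lies in $I(w)$). A set of three roots $\{\alpha,\beta,\gamma\}\subseteq\Phi$ is a root-triple if there exist real $a,b,c>0$ with $a\alpha+b\beta+c\gamma=0$. A nonempty subset $D\subseteq W$ is a Condorcet domain if there do not exist distinct $u,v,w\in D$ and a root-triple $\{\alpha,\beta,\gamma\}$ such that $\alpha,\beta\in I(u)$, $\alpha,\gamma\in I(v)$, $\beta,\gamma\in I(w)$. A Condorcet domain is maximal if it is not properly contained in another Condorcet domain in $W$. $D$ is connected if for any $u,v\in D$ there exist $m\ge0$ and a sequence $w_0=u,w_1,\dots,w_m=v$ in $D$ with $|I(w_{i+1})\setminus I(w_i)|=1$ for all $0\le i\le m-1$. For $\gamma\in\Phi$ let $D(\gamma)=\{v\in D\mid\gamma\in I(v)\}$; $\varphi(D)$ is the preposet (reflexive transitive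 relation) on $\Phi$ with $\alpha\le\beta$ if and only if $D(\alpha)\supseteq D(\beta)$. A Condorcet domain $D$ is peak-pit if for every root-triple there is a labelling $\{\alpha,\beta,\gamma\}$ of its elements such that $\alpha\ge-\gamma\ge\beta$ in $\varphi(D)$. *)

(* Defs.v *)
From HB Require Import structures.
From mathcomp Require Import all_boot all_order all_algebra.
From mathcomp Require Import all_classical all_reals.

Set Implicit Arguments.
Unset Strict Implicit.
Unset Printing Implicit Defensive.

Import Order.TTheory GRing.Theory Num.Theory.

Local Open Scope classical_set_scope.
Local Open Scope card_scope.
Local Open Scope ring_scope.

(* The Euclidean space is R^n (column vectors) with the standard inner
   product; linear maps are matrices acting by left multiplication. *)

Definition dot (R : realType) (n : nat) (u v : 'cV[R]_n) : R :=
  \sum_(i < n) u i 0 * v i 0.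

(* The orthogonal reflection in the hyperplane orthogonal to [a], for
   nonzero [a]; see [reflE] for its usual formula on vectors. *)
Definition refl (R : realType) (n : nat) (a : 'cV[R]_n) : 'M[R]_n :=
  1%:M - (2 / dot a a) *: (a *m a^T).

Lemma reflE (R : realType) (n : nat) (a v : 'cV[R]_n) :
  refl a *m v = v - (2 * dot a v / dot a a) *: a.
Proof.
rewrite /refl mulmxBl mul1mx -scalemxAl -mulmxA; congr (_ - _).
have -> : a^T *m v = (dot a v)%:M.
  apply/matrixP => i j; rewrite !ord1 !mxE mulr1n.
  by apply: eq_bigr => k _; rewrite mxE.
by rewrite mul_mx_scalar scalerA mulrAC.
Qed.

Definition root_system (R : realType) (n : nat) (Phi : set 'cV[R]_n) : Prop :=
  [/\ finite_set Phi,
      ~ Phi 0,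
      forall a, Phi a ->
        Phi `&` [set c *: a | c in [set: R]] = [set a; - a]
    & forall a, Phi a -> [set refl a *m b | b in Phi] = Phi].

(* A choice of positive roots: the roots on the positive side of a linear
   hyperplane that contains no root. *)
Definition positive_system (R : realType) (n : nat)
    (Phi Phip : set 'cV[R]_n) : Prop :=
  exists l : 'cV[R]_n,
    (forall a, Phi a -> dot l a != 0) /\
    Phip = [set a | Phi a /\ 0 < dot l a].

Inductive coxeter_group (R : realType) (n : nat) (Phi : set 'cV[R]_n) :
    set 'M[R]_n :=
  | coxeter_one : coxeter_group Phi 1%:M
  | coxeter_refl a : Phi a -> coxeter_group Phi (refl a)
  | coxeter_mul u v :
      coxeter_group Phi u -> coxeter_group Phi v -> coxeter_group Phi (u *m v)
  | coxeter_inv u : coxeter_group Phi u -> coxeter_group Phi (invmx u).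

Definition inversions (R : realType) (n : nat) (Phi Phip : set 'cV[R]_n)
    (w : 'M[R]_n) : set 'cV[R]_n :=
  [set a | Phi a /\ (Phi `\` Phip) (invmx w *m a)].

Definition root_triple (R : realType) (n : nat) (Phi : set 'cV[R]_n)
    (T : set 'cV[R]_n) : Prop :=
  T `<=` Phi /\
  exists a b c : 'cV[R]_n,
    [/\ T = [set a; b; c],
        [/\ a != b, a != c & b != c]
      & exists x y z : R,
          [/\ 0 < x, 0 < y, 0 < z & x *: a + y *: b + z *: c = 0]].

Definition condorcet_domain (R : realType) (n : nat) (Phi Phip : set 'cV[R]_n)
    (D : set 'M[R]_n) : Prop :=
  [/\ D !=set0,
      D `<=` coxeter_group Phi
    & ~ exists (u v w : 'M[R]_n) (a b c : 'cV[R]_n),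
          [/\ [/\ D u, D v & D w],
              [/\ u != v, u != w & v != w],
              root_triple Phi [set a; b; c]
            & [/\ inversions Phi Phip u a /\ inversions Phi Phip u b,
                  inversions Phi Phip v a /\ inversions Phi Phip v c
                & inversions Phi Phip w b /\ inversions Phi Phip w c]]].

Definition maximal_condorcet_domain (R : realType) (n : nat)
    (Phi Phip : set 'cV[R]_n) (D : set 'M[R]_n) : Prop :=
  condorcet_domain Phi Phip D /\
  ~ exists D' : set 'M[R]_n, condorcet_domain Phi Phip D' /\ D `<` D'.

Definition connected_domain (R : realType) (n : nat) (Phi Phip : set 'cV[R]_n)
    (D : set 'M[R]_n) : Prop :=
  forall u v : 'M[R]_n, D u -> D v ->
    exists (m : nat) (w : nat -> 'M[R]_n),
      [/\ w 0%N = u, w m = v,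
          forall i, (i <= m)%N -> D (w i)
        & forall i, (i < m)%N ->
            inversions Phi Phip (w i.+1) `\` inversions Phi Phip (w i) #= `I_1].

Definition subdomain (R : realType) (n : nat) (Phi Phip : set 'cV[R]_n)
    (D : set 'M[R]_n) (g : 'cV[R]_n) : set 'M[R]_n :=
  [set v | D v /\ inversions Phi Phip v g].

(* [preposet Phi Phip D a b] reads "a <= b in phi(D)"; the relation lives on
   Phi, and it reverses the inclusion of the sets D(a). *)
Definition preposet (R : realType) (n : nat) (Phi Phip : set 'cV[R]_n)
    (D : set 'M[R]_n) (a b : 'cV[R]_n) : Prop :=
  [/\ Phi a, Phi b & subdomain Phi Phip D b `<=` subdomain Phi Phip D a].

Definition peak_pit (R : realType) (n : nat) (Phi Phip : set 'cV[R]_n)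
    (D : set 'M[R]_n) : Prop :=
  forall T : set 'cV[R]_n, root_triple Phi T ->
    exists a b c : 'cV[R]_n,
      [/\ T = [set a; b; c],
          preposet Phi Phip D (- c) a
        & preposet Phi Phip D b (- c)].

(* Main.v *)
Require Import Defs.
From mathcomp Require Import all_boot all_order all_algebra.
From mathcomp Require Import all_classical all_reals.
From mathcomp Require Import ring lra.

Set Implicit Arguments.
Unset Strict Implicit.
Unset Printing Implicit Defensive.

Import Order.TTheory GRing.Theory Num.Theory.

Local Open Scope classical_set_scope.
Local Open Scope ring_scope.

(** Write [W] for the Coxeter group, [l] for a vector that defines the positive
    roots and [inv w] for the inversion set of [w]. It consists of the roots
    that are positive on the chamber vector [- w l], and a step of a connected
    domain crosses one wall between chambers. The trace of [w] on a root-triple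
    [{a, b, c}] is the intersection of [inv w] with the triple. It is never
    empty and never the whole triple; the six remaining traces form a hexagon,
    in which [{a}] is adjacent to [{a, b}] and [{a, c}], and crossing a wall
    leaves a trace in place or moves it to an adjacent one. The Condorcet
    condition says that one of the three two-element traces and, by passing to
    the opposite triple, one of the three one-element traces do not occur in
    [D]. Peak-pit says that two adjacent traces do not occur.

    If [D] is connected then the traces that occur form a connected part of the
    hexagon, so that whenever two opposite traces are missing an adjacent pair
    is missing too ([connected_triple]).

    Conversely, let [D] be maximal and peak-pit, and let [u] and [v] be
    distinct in [D]. Since chambers determine group elements
    ([inversions_inj]), [inv v] contains roots outside [inv u]; let [d0] be
    minimal among them for the preposet of [D]. Switching the signs in [inv u]
    of the roots below [d0] gives an ideal of the preposet that contains one of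
    each pair of opposite roots, and on such ideals peak-pit forces closedness
    under positive combinations ([ideal_pos_closed]). Because the simple roots
    of a chamber generate all its positive roots, some wall of [u] belongs to a
    switched root [d] ([inversions_adjacent]). Let [x] be the element across
    this wall. Minimality of [d] and peak-pit together show that [D] stays a
    Condorcet domain when [x] is added ([peak_pit_adjacent]), so [x] lies in
    [D] by maximality, and it is one wall closer to [v] than [u].

    The facts on reflection groups behind this are that a non-simple positive
    root can be lowered by a simple reflection ([simple_root_ind]), and the
    exchange property of words ([exchange]). *)

(** * Induction over finite sets *)

Section FiniteInduction.

Context {T : Type} {X : set T} (finX : finite_set X).

(** Every use of finiteness below is an instance of this rank, which avoids
    attaching cardinalities to classical sets. *)
Lemma finite_set_rank :
  exists rk : set T -> nat, forall A B, A `<=` B ->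
    forall x, X x -> B x -> ~ A x -> (rk A < rk B)%N.
Proof.
have /(@finite_seqP {classic T})[s Xs] := finX.
exists (fun A => count (fun a => `[< A a >]) s) => A B AB x Xx Bx nAx.
have xs : (x : {classic T}) \in s by move: Xx; rewrite Xs.
have subAB : subpred (fun a : T => `[< A a >]) (fun a => `[< B a >]).
  by move=> a /asboolP Aa; apply/asboolP; exact: AB.
elim: s xs {Xs} => //= a s IHs; rewrite inE => /predU1P[<-|xs].
  have /asboolPn/negPf -> := nAx; have /asboolP -> := Bx.
  by rewrite add0n add1n ltnS; exact: sub_count.
rewrite -addnS leq_add ?IHs//.
by case: asboolP => // /AB/asboolP ->.
Qed.

Lemma finite_set_ind (lt : T -> T -> Prop) (P : T -> Prop) :
    (forall a, ~ lt a a) ->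
    (forall a b c, lt a b -> lt b c -> lt a c) ->
    (forall a, X a -> (forall b, X b -> lt b a -> P b) -> P a) ->
  forall a, X a -> P a.
Proof.
move=> ltxx lt_trans IH; have [rk rk_lt] := finite_set_rank.
suff below k a : (rk (lt^~ a) < k)%N -> X a -> P a by move=> a; exact: below.
elim: k a => // k IHk a; rewrite ltnS => ak Xa; apply: (IH a Xa) => b Xb ba.
apply: IHk => //; apply: leq_trans ak.
by apply: (rk_lt _ _ _ b) => // c cb; exact: lt_trans ba.
Qed.

End FiniteInduction.

(** * Inner products and reflections *)

Section InnerProduct.

Context {R : realType} {n : nat}.
Implicit Types (a b c u v : 'cV[R]_n) (A w : 'M[R]_n).

Lemma dotE u v : dot u v = (u^T *m v) 0 0.
Proof. by rewrite mxE; apply: eq_bigr => i _; rewrite mxE. Qed.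

Lemma dotC u v : dot u v = dot v u.
Proof. by apply: eq_bigr => i _; rewrite mulrC. Qed.

Lemma dotDr u v v' : dot u (v + v') = dot u v + dot u v'.
Proof. by rewrite !dotE mulmxDr mxE. Qed.

Lemma dotZr x u v : dot u (x *: v) = x * dot u v.
Proof. by rewrite !dotE -scalemxAr mxE. Qed.

Lemma dotNr u v : dot u (- v) = - dot u v.
Proof. by rewrite !dotE mulmxN mxE. Qed.

Lemma dotDl u u' v : dot (u + u') v = dot u v + dot u' v.
Proof. by rewrite !(dotC _ v) dotDr. Qed.

Lemma dotZl x u v : dot (x *: u) v = x * dot u v.
Proof. by rewrite !(dotC _ v) dotZr. Qed.

Lemma dotNl u v : dot (- u) v = - dot u v.
Proof. by rewrite !(dotC _ v) dotNr. Qed.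

Lemma dot0r u : dot u 0 = 0.
Proof. by rewrite dotE mulmx0 mxE. Qed.

Lemma dot_mulmxl A u v : dot (A *m u) v = dot u (A^T *m v).
Proof. by rewrite !dotE trmx_mul mulmxA. Qed.

Lemma dot_gt0 a : a != 0 -> 0 < dot a a.
Proof.
move=> a_neq0; rewrite lt_neqAle sumr_ge0 ?andbT => [|i _]; last first.
  by rewrite -expr2 sqr_ge0.
apply: contra a_neq0; rewrite eq_sym psumr_eq0 => [/allP a0|i _]; last first.
  by rewrite -expr2 sqr_ge0.
apply/eqP/matrixP => i j; rewrite ord1 mxE.
by have := a0 i (mem_index_enum i); rewrite /= mulf_eq0 orbb => /eqP.
Qed.

Lemma cauchy_schwarz a b : a != 0 -> (forall t, b != t *: a) ->
  (dot a b) ^+ 2 < dot a a * dot b b.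
Proof.
move=> a_neq0 nba; have aa := dot_gt0 a_neq0.
have := nba (dot a b / dot a a); rewrite -subr_eq0 => /dot_gt0.
rewrite !(dotDl, dotDr, dotNl, dotNr, dotZl, dotZr) (dotC b a).
rewrite mulfVK ?gt_eqF// => h.
have : 0 < dot a a * (dot b b - dot a b / dot a a * dot a b).
  by rewrite mulr_gt0//; lra.
by rewrite mulrBr mulrA mulrCA divff ?gt_eqF// mulr1; lra.
Qed.

Lemma reflN a : refl (- a) = refl a.
Proof.
rewrite /refl dotNl dotNr opprK; congr (_ - _ *: _).
by rewrite mulNmx linearN mulmxN opprK.
Qed.

Lemma refl_self a : a != 0 -> refl a *m a = - a.
Proof.
move=> /dot_gt0 aa; rewrite reflE mulfK ?gt_eqF//.
by rewrite scaler_nat mulr2n opprD addNKr.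
Qed.

Lemma reflK a : a != 0 -> refl a *m refl a = 1%:M.
Proof.
move=> a_neq0; rewrite {2}/refl mulmxBr mulmx1 -scalemxAr mulmxA refl_self//.
by rewrite mulNmx scalerN opprK /refl subrK.
Qed.

Lemma trmx_refl a : (refl a)^T = refl a.
Proof. by rewrite /refl linearB linearZ /= trmx1 trmx_mul trmxK. Qed.

Definition orthogonal w := w^T *m w = 1%:M.

Lemma orthogonalV w : orthogonal w -> w *m w^T = 1%:M.
Proof. by move/mulmx1C. Qed.

Lemma orthogonal_unit w : orthogonal w -> w \in unitmx.
Proof. by move/mulmx1_unit => []. Qed.

Lemma orthogonal_inv w : orthogonal w -> invmx w = w^T.
Proof.
by move=> ow; rewrite -[RHS]mulmx1 -(mulmxV (orthogonal_unit ow)) mulmxA ow mul1mx.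
Qed.

Lemma dot_orthogonal w u v : orthogonal w -> dot (w *m u) (w *m v) = dot u v.
Proof. by move=> ow; rewrite dot_mulmxl mulmxA ow mul1mx. Qed.

Lemma orthogonal_refl a : a != 0 -> orthogonal (refl a).
Proof. by move=> a_neq0; rewrite /orthogonal trmx_refl reflK. Qed.

Lemma orthogonalM w w' : orthogonal w -> orthogonal w' -> orthogonal (w *m w').
Proof.
by rewrite /orthogonal => ow ow'; rewrite trmx_mul -mulmxA (mulmxA w^T) ow mul1mx.
Qed.

Lemma orthogonal_tr w : orthogonal w -> orthogonal w^T.
Proof. by move=> ow; rewrite /orthogonal trmxK orthogonalV. Qed.

(** This is [s_(w a) = w s_a w^-1], kept free of inverses. *)
Lemma refl_conj w a : orthogonal w -> refl (w *m a) *m w = w *m refl a.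
Proof.
move=> ow; rewrite /refl dot_orthogonal// mulmxBl mulmxBr mul1mx mulmx1.
by rewrite -scalemxAl -scalemxAr trmx_mul !mulmxA -(mulmxA _ w^T) ow mulmx1.
Qed.

End InnerProduct.

(** * Simple roots *)

Section RootSystem.

Context {R : realType} {n : nat} {Phi : set 'cV[R]_n}.
Hypothesis rootPhi : root_system Phi.
Implicit Types (a b c d g l m u v : 'cV[R]_n) (w : 'M[R]_n).

Let W := coxeter_group Phi.

Lemma root_finite : finite_set Phi.
Proof. by case: rootPhi. Qed.

Lemma root_neq0 a : Phi a -> a != 0.
Proof. by case: rootPhi => _ P0 _ _ Pa; apply/eqP => a0; apply: P0; rewrite -a0. Qed.

Lemma root_opp a : Phi a -> Phi (- a).
Proof.
case: rootPhi => _ _ line _ Pa.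
have : [set a; - a] (- a) by right.
by rewrite -(line a Pa) => -[].
Qed.

Lemma root_oppE a : Phi (- a) <-> Phi a.
Proof. by split=> [/root_opp|/root_opp//]; rewrite opprK. Qed.

Lemma root_colinear a x : Phi a -> Phi (x *: a) -> x *: a = a \/ x *: a = - a.
Proof.
case: rootPhi => _ _ line _ Pa Pxa.
suff : [set a; - a] (x *: a) by [].
by rewrite -(line a Pa); split=> //; exists x.
Qed.

Lemma root_refl a b : Phi a -> Phi (refl a *m b) <-> Phi b.
Proof.
case: rootPhi => _ _ _ stab Pa.
have fwd c : Phi c -> Phi (refl a *m c).
  by move=> Pc; rewrite -(stab a Pa); exists c.
split=> [/fwd|/fwd//]; by rewrite mulmxA reflK ?mul1mx// root_neq0.
Qed.

Lemma coxeter_orthogonal w : W w -> orthogonal w.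
Proof.
elim=> {w} [|a Pa|w w' _ ow _ ow'|w _ ow].
- by rewrite /orthogonal trmx1 mulmx1.
- exact/orthogonal_refl/root_neq0.
- exact: orthogonalM.
- by rewrite orthogonal_inv//; exact: orthogonal_tr.
Qed.

Lemma coxeter_root w : W w -> forall a, Phi (w *m a) <-> Phi a.
Proof.
elim=> {w} [|b Pb|w w' _ IHw _ IHw'|w Ww IHw] a.
- by rewrite mul1mx.
- exact: root_refl.
- by rewrite -mulmxA IHw IHw'.
- have := IHw (invmx w *m a); rewrite mulmxA mulmxV ?mul1mx; first exact: iff_sym.
  exact/orthogonal_unit/coxeter_orthogonal.
Qed.

Definition regular m := forall a, Phi a -> dot m a != 0.

(** Simplicity is taken to be the property of simple reflections that the
    arguments use, rather than extremality in the cone of positive roots. *)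
Definition simple m d :=
  [/\ Phi d, 0 < dot m d &
    forall g, Phi g -> 0 < dot m g -> g <> d -> 0 < dot m (refl d *m g)].

Lemma regular_neg m a : regular m -> Phi a -> ~ 0 < dot m a -> 0 < dot m (- a).
Proof.
move=> reg Pa /negP; rewrite -leNgt dotNr oppr_gt0 => ma.
by rewrite lt_neqAle reg.
Qed.

Let norm a := Num.sqrt (dot a a).
Let height m a := dot m a / norm a.

Let norm_gt0 a : Phi a -> 0 < norm a.
Proof. by move=> /root_neq0/dot_gt0; rewrite sqrtr_gt0. Qed.

Let norm_refl d a : Phi d -> norm (refl d *m a) = norm a.
Proof.
by move=> /root_neq0/orthogonal_refl od; rewrite /norm dot_orthogonal.
Qed.

(** If [s_a] makes the positive root [g] negative then
    [g + b = 2 <a,g> / <a,a> a] with [b = - s_a g] positive. Strict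
    Cauchy-Schwarz bounds the coefficient by [2 |g| / |a|], so that one of
    [g] and [b], both as long as [g], is lower than [a] once heights are
    divided by lengths. *)
Lemma not_simple_lower m a : regular m -> Phi a -> 0 < dot m a ->
  ~ simple m a ->
  exists g, [/\ Phi g, 0 < dot m g, 0 < dot a g & height m g < height m a].
Proof.
move=> reg Pa ma nsimp.
have [g [Pg mg ga sg]] : exists g, [/\ Phi g, 0 < dot m g, g <> a &
    ~ 0 < dot m (refl a *m g)].
  apply: contrapT => no; apply: nsimp; split=> // g Pg mg ga.
  by apply: contrapT => sg; apply: no; exists g.
pose b := - (refl a *m g).
have Pb : Phi b by apply/root_oppE/(root_refl _ Pa).
have mb : 0 < dot m b by apply: regular_neg => //; apply/(root_refl _ Pa).
have a_neq0 := root_neq0 Pa; have aa := dot_gt0 a_neq0.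
have defb : b = (2 * dot a g / dot a a) *: a - g.
  by rewrite /b reflE opprB.
have norm_b : norm b = norm g.
  by rewrite /norm /b dotNl dotNr opprK; exact: norm_refl.
have mgb : dot m g + dot m b = 2 * dot a g / dot a a * dot m a.
  by rewrite defb dotDr dotNr dotZr addrC subrK.
have ag : 0 < dot a g.
  have : 0 < 2 * dot a g / dot a a * dot m a by rewrite -mgb addr_gt0.
  by rewrite pmulr_lgt0// pmulr_lgt0 ?invr_gt0// pmulr_rgt0.
have ab : dot a b = dot a g.
  rewrite defb dotDr dotZr dotNr mulfVK ?gt_eqF//; lra.
have na := norm_gt0 Pa; have ng := norm_gt0 Pg.
have na2 : dot a a = norm a ^+ 2 by rewrite sqr_sqrtr// ltW.
have ng2 : dot g g = norm g ^+ 2.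
  by rewrite sqr_sqrtr// ltW// dot_gt0// root_neq0.
have CS : dot a g < norm a * norm g.
  rewrite -(@ltr_pXn2r _ 2%N)// ?nnegrE ?ltW// ?mulr_gt0//.
  rewrite exprMn -na2 -ng2 cauchy_schwarz// => t; apply/eqP => gt.
  move: (Pg); rewrite gt => /(root_colinear Pa)[] gta; first by rewrite gt in ga.
  by move: mg; rewrite gt gta dotNr; lra.
have [hg|hg] := ltP (height m g) (height m a); first by exists g.
exists b; split=> //; first by rewrite ab.
rewrite ltNge; apply/negP => hb.
have lowg : height m a * norm g <= dot m g by rewrite -ler_pdivlMr.
have lowb : height m a * norm g <= dot m b by rewrite -norm_b -ler_pdivlMr// norm_b.
have : dot m g + dot m b < 2 * (height m a * norm g).
  have -> : dot m g + dot m b = 2 * (height m a * (dot a g / norm a)).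
    by rewrite mgb na2 /height; field; rewrite gt_eqF.
  by rewrite !ltr_pM2l// ?divr_gt0// ltr_pdivrMr// mulrC.
by lra.
Qed.

Lemma height_ind m (P : 'cV[R]_n -> Prop) :
    (forall a, Phi a -> 0 < dot m a ->
      (forall b, Phi b -> 0 < dot m b -> height m b < height m a -> P b) ->
      P a) ->
  forall a, Phi a -> 0 < dot m a -> P a.
Proof.
move=> IH; pose lt a b := height m a < height m b.
apply: (@finite_set_ind _ _ root_finite lt) => [a|a b c|a Pa IHa ma].
- by rewrite /lt ltxx.
- exact: lt_trans.
- by apply: IH => // b Pb mb ba; exact: IHa.
Qed.

Lemma simple_refl_lower m a d : Phi a -> simple m d -> 0 < dot a d ->
  height m (refl d *m a) < height m a.
Proof.
move=> Pa [Pd md _] ad; rewrite /height norm_refl//.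
rewrite ltr_pM2r ?invr_gt0 ?norm_gt0// reflE dotDr dotNr dotZr.
rewrite ltrBlDr ltrDl mulr_gt0// divr_gt0 ?mulr_gt0 ?dot_gt0 ?root_neq0//.
by rewrite dotC.
Qed.

(** Positive roots are nonnegative combinations of simple roots; a linear
    functional that is positive on the former is positive on one of the latter.
    This consequence is all that [simple_root_ind] requires. *)
Lemma positive_simple_dot m : regular m ->
  forall a, Phi a -> 0 < dot m a ->
  forall z, 0 < dot z a -> exists d, simple m d /\ 0 < dot z d.
Proof.
move=> reg; apply: height_ind => a Pa ma IH z za.
have [sa|nsa] := pselect (simple m a); first by exists a.
have [g [Pg mg ag ga]] := not_simple_lower reg Pa ma nsa.
have [d [sd ad]] := IH g Pg mg ga _ ag; have [Pd md posd] := sd.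
have [zd|zd] := ltP 0 (dot z d); first by exists d.
apply: (IH (refl d *m a)); first exact/root_refl.
- by apply: posd => // ad'; apply: nsa; rewrite ad'.
- exact: simple_refl_lower.
rewrite reflE dotDr dotNr dotZr; apply: lt_le_trans za _.
rewrite lerDl oppr_ge0 mulr_ge0_le0// divr_ge0 ?mulr_ge0//.
  by rewrite dotC ltW.
by rewrite ltW// dot_gt0 ?root_neq0.
Qed.

(** Induction along simple reflections that lower a positive root: every
    positive root is reached from the simple ones by adding positive multiples
    of simple roots. *)
Lemma simple_root_ind m (P : 'cV[R]_n -> Prop) : regular m ->
    (forall d, simple m d -> P d) ->
    (forall a d, Phi a -> simple m d -> 0 < dot a d ->
      P (refl d *m a) -> P a) ->
  forall a, Phi a -> 0 < dot m a -> P a.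
Proof.
move=> reg Psimple Pstep; apply: height_ind => a Pa ma IH.
have [sa|nsa] := pselect (simple m a); first exact: Psimple.
have [d [sd ad]] := positive_simple_dot reg Pa ma (dot_gt0 (root_neq0 Pa)).
have [Pd _ posd] := sd.
apply: (Pstep a d) => //; apply: IH; first exact/root_refl.
- by apply: posd => // ad'; apply: nsa; rewrite ad'.
- exact: simple_refl_lower.
Qed.

(** * Words in the simple reflections *)

Let word (ds : seq 'cV[R]_n) : 'M[R]_n :=
  foldr (fun d w => refl d *m w) 1%:M ds.

Let simple_word l (ds : seq 'cV[R]_n) := forall d, d \in ds -> simple l d.

Lemma word_cat ds ds' : word (ds ++ ds') = word ds *m word ds'.
Proof. by elim: ds => [|d ds IH] /=; rewrite ?mul1mx// IH mulmxA. Qed.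

Lemma simple_word_cons l d ds :
  simple_word l (d :: ds) <-> simple l d /\ simple_word l ds.
Proof.
split=> [h|[sd sds] e]; last by rewrite inE => /predU1P[->//|/sds].
by split=> [|e ee]; apply: h; rewrite inE ?eqxx// ee orbT.
Qed.

Lemma simple_word_cat l ds ds' :
  simple_word l ds -> simple_word l ds' -> simple_word l (ds ++ ds').
Proof. by move=> h h' d; rewrite mem_cat => /orP[/h|/h']. Qed.

Lemma word_coxeter l ds : simple_word l ds -> W (word ds).
Proof.
elim: ds => [|d ds IH] /=; first by move=> _; exact: coxeter_one.
move=> /simple_word_cons[[Pd _ _] /IH]; apply: coxeter_mul; exact: coxeter_refl.
Qed.

Lemma coxeter_word l w : regular l -> W w ->
  exists2 ds, simple_word l ds & w = word ds.
Proof.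
move=> reg; elim=> {w} [|a Pa|w w' _ [ds sds ->] _ [ds' sds' ->]|w Ww [ds sds ->]].
- by exists [::].
- wlog pos : a Pa / 0 < dot l a.
    move=> H; have [/H//|] := pselect (0 < dot l a); first exact.
    move=> /(regular_neg reg Pa); rewrite -(reflN a); apply: H; exact: root_opp.
  move: a Pa pos; apply: (simple_root_ind reg) => [d sd|a d Pa sd _ [ds sds wa]].
    exists [:: d]; last by rewrite /= mulmx1.
    by apply/simple_word_cons; split.
  have [Pd _ _] := sd; have d_neq0 := root_neq0 Pd.
  exists ([:: d] ++ ds ++ [:: d]).
    by do 2?[apply: simple_word_cat] => //; apply/simple_word_cons; split.
  rewrite !word_cat /= !mulmx1 -wa refl_conj; last exact: orthogonal_refl.
  by rewrite mulmxA reflK// mul1mx.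
- by exists (ds ++ ds'); [exact: simple_word_cat | rewrite word_cat].
- exists (rev ds); first by move=> d; rewrite mem_rev => /sds.
  have -> : invmx (word ds) = (word ds)^T.
    exact/orthogonal_inv/coxeter_orthogonal/(word_coxeter sds).
  elim: ds {sds} => [|d ds IH] /=; first by rewrite trmx1.
  by rewrite rev_cons -cats1 word_cat -IH /= mulmx1 trmx_mul trmx_refl.
Qed.

(** Following [d] through the word, the first letter that makes it negative is
    the image of [d] under the later letters, so these conjugate [s_d] to that
    letter. *)
Lemma exchange l ds d : regular l -> simple_word l ds -> simple l d ->
  0 < dot l (- (word ds *m d)) ->
  exists ds', [/\ simple_word l ds', (size ds' < size ds)%N &
    word ds *m refl d = word ds'].
Proof.
move=> reg sds sd; have [Pd ld _] := sd.
elim: ds sds => [|e ds IH] /=.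
  by rewrite mul1mx dotNr => _; lra.
move=> /simple_word_cons[se sds] neg; have [Pe le pose] := se.
have Wds := word_coxeter sds.
have Pb : Phi (word ds *m d) by apply/(coxeter_root Wds).
have [pos|/(regular_neg reg Pb)/(IH sds)[ds' [sds' lt_ds' eq_ds']]] :=
    pselect (0 < dot l (word ds *m d)); last first.
  exists (e :: ds'); split=> //=; first by apply/simple_word_cons; split.
  by rewrite -mulmxA eq_ds'.
have be : word ds *m d = e.
  apply: contrapT => /(pose _ Pb pos).
  by move: neg; rewrite dotNr -mulmxA; lra.
exists ds; split=> //; rewrite -mulmxA -refl_conj; last exact: coxeter_orthogonal.
by rewrite be mulmxA reflK ?mul1mx// root_neq0.
Qed.

(** Exchange applied to the last letter shortens a word for [w] by two. *)
Lemma coxeter_free l w : regular l -> W w ->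
  (forall a, Phi a -> 0 < dot l a -> 0 < dot l (w *m a)) -> w = 1%:M.
Proof.
move=> reg /(coxeter_word reg)[ds sds ->].
have [k] := ubnP (size ds); elim: k ds sds => // k IHk ds.
case/lastP: ds => [//|ds d]; rewrite -cats1 size_cat addn1 ltnS => sds lt_k pos.
have sd : simple l d by apply: sds; rewrite mem_cat mem_seq1 eqxx orbT.
have {}sds : simple_word l ds by move=> e ee; apply: sds; rewrite mem_cat ee.
have [Pd ld _] := sd.
have [|ds' [sds' lt_ds' eq_ds']] := exchange reg sds sd.
  rewrite -mulmxN -refl_self ?root_neq0//.
  by have := pos d Pd ld; rewrite word_cat /= mulmx1 mulmxA.
have eqw : word (ds ++ [:: d]) = word ds' by rewrite word_cat /= mulmx1.
rewrite eqw in pos *; apply: IHk => //; exact: leq_trans lt_ds' (ltnW lt_k).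
Qed.

End RootSystem.

(** * Inversion sets *)

Section Inversions.

Context {R : realType} {n : nat} {Phi : set 'cV[R]_n} {l : 'cV[R]_n}.
Hypotheses (rootPhi : root_system Phi) (reg : regular (Phi := Phi) l).
Implicit Types (a b c d e g : 'cV[R]_n) (p q r u v w x : 'M[R]_n).

Let W := coxeter_group Phi.
Let Phip : set 'cV[R]_n := [set a | Phi a /\ 0 < dot l a].
Let inv := inversions Phi Phip.

Lemma inversionsP w a : W w ->
  inv w a <-> Phi a /\ 0 < dot (- (w *m l)) a.
Proof.
move=> Ww; have ow := coxeter_orthogonal rootPhi Ww.
have Pw : Phi (invmx w *m a) <-> Phi a.
  exact: (coxeter_root rootPhi (coxeter_inv Ww)).
have -> : dot (- (w *m l)) a = - dot l (invmx w *m a).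
  by rewrite dotNl dot_mulmxl orthogonal_inv.
split=> [[Pa [Pwa nwa]]|[Pa neg]]; split=> //.
  by rewrite -dotNr (regular_neg reg)// => pos; apply: nwa.
by split; [exact/Pw|case=> _; lra].
Qed.

Lemma inversions_root w a : inv w a -> Phi a.
Proof. by case. Qed.

Lemma regular_chamber w : W w -> regular (Phi := Phi) (- (w *m l)).
Proof.
move=> Ww a Pa; rewrite dotNl oppr_eq0 dot_mulmxl.
rewrite -orthogonal_inv; last exact: (coxeter_orthogonal rootPhi).
by apply: reg; exact/(coxeter_root rootPhi (coxeter_inv Ww)).
Qed.

Lemma inversions_opp w a : W w -> Phi a -> inv w (- a) <-> ~ inv w a.
Proof.
move=> Ww Pa; rewrite !inversionsP//; split=> [[_]|nwa].
  by rewrite dotNr => neg [_]; lra.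
split; first exact: root_opp.
apply: (regular_neg (regular_chamber Ww)) => // pos; exact: nwa.
Qed.

Lemma inversions_inj u v : W u -> W v -> inv u = inv v -> u = v.
Proof.
move=> Wu Wv uv.
have [ou ov] := (coxeter_orthogonal rootPhi Wu, coxeter_orthogonal rootPhi Wv).
have Ww : W (invmx u *m v) by apply: coxeter_mul => //; exact: coxeter_inv.
have ow := coxeter_orthogonal rootPhi Ww.
have w1 : invmx (invmx u *m v) = 1%:M.
  apply: (coxeter_free rootPhi reg); first exact: coxeter_inv.
  move=> a Pa la.
  have Pua : Phi (u *m a) by exact/(coxeter_root rootPhi Wu).
  have nu : ~ inv u (u *m a).
    rewrite inversionsP// dotNl dot_orthogonal// => -[_].
    by rewrite oppr_gt0; lra.
  have : inv v (- (u *m a)) by apply/inversions_opp => //; rewrite -uv.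
  rewrite inversionsP// dotNl dotNr opprK dot_mulmxl => -[_].
  by rewrite (orthogonal_inv ow) (orthogonal_inv ou) trmx_mul trmxK mulmxA.
have uU := orthogonal_unit ou.
have := congr1 (mulmx (invmx u *m v)) w1.
rewrite mulmxV ?orthogonal_unit// mulmx1 => /(congr1 (mulmx u)).
by rewrite mulmx1 mulmxA mulmxV// mul1mx.
Qed.

(** A root-triple spans a plane and has the origin in the interior of its
    convex hull there, so no closed half-plane through the origin contains it. *)
Lemma triple_dot T m : root_triple Phi T -> (forall t, T t -> 0 <= dot m t) ->
  forall t, T t -> dot m t = 0.
Proof.
move=> [_ [a [b [c [-> _ [x [y [z [x0 y0 z0 abc]]]]]]]]] nneg.
have [a0 b0 c0] : [/\ 0 <= dot m a, 0 <= dot m b & 0 <= dot m c].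
  by split; apply: nneg; [left; left|left; right|right].
have xa := mulr_ge0 (ltW x0) a0; have yb := mulr_ge0 (ltW y0) b0.
have zc := mulr_ge0 (ltW z0) c0.
have /eqP := dot0r m; rewrite -abc !dotDr !dotZr.
rewrite paddr_eq0 ?addr_ge0// paddr_eq0// !mulf_eq0.
rewrite (gt_eqF x0) (gt_eqF y0) (gt_eqF z0) /=.
by move=> /andP[/andP[/eqP ma /eqP mb] /eqP mc] t [[->|->]|->].
Qed.

Lemma triple_not_inversions T w : root_triple Phi T -> W w ->
  ~ (forall a, T a -> inv w a).
Proof.
move=> tr Ww sub.
have pos t : T t -> 0 < dot (- (w *m l)) t by move=> /sub /(inversionsP _ Ww)[].
have [a Ta] : exists a, T a.
  by have [_ [a [b [c [-> _ _]]]]] := tr; exists a; left; left.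
have := triple_dot tr (fun t Tt => ltW (pos t Tt)) Ta.
by have := pos a Ta; lra.
Qed.

(** If [b = - a] then the component of [c] orthogonal to [a] is nonnegative on
    the triple, hence zero; but a line contains only two roots. *)
Lemma triple_neq_opp a b c : root_triple Phi [set a; b; c] -> b <> - a.
Proof.
move=> tr bNa; have [Pa Pc] : Phi a /\ Phi c.
  by case: tr => sub _; split; apply: sub; [left; left|right].
have aa := dot_gt0 (root_neq0 rootPhi Pa).
pose k := dot a c / dot a a; pose m := c - k *: a.
have ma : dot m a = 0.
  by rewrite /m dotDl dotNl dotZl (dotC c) mulfVK ?subrr ?gt_eqF.
have mc : dot m c = dot m m by rewrite {3}/m dotDr dotNr dotZr ma mulr0 subr0.
have m0 : m = 0.
  apply: contrapT => /eqP /dot_gt0; rewrite -mc.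
  rewrite (triple_dot (m := m) tr) ?ltxx//; last by right.
  have [->|/dot_gt0/ltW mm] := eqVneq m 0.
    by move=> t _; rewrite dotC dot0r.
  by move=> t [[->|->]|->]; rewrite ?bNa ?dotNr ?ma ?oppr0// mc.
have cE : c = k *: a by apply/eqP; rewrite -subr_eq0; exact/eqP.
have ca : c = a \/ c = - a.
  by have := root_colinear (x := k) rootPhi Pa; rewrite -cE; exact.
case: tr => _ [d [e [f [eqT [de df ef] _]]]].
have sub t : [set d; e; f] t -> t = a \/ t = - a.
  by rewrite -eqT bNa => -[[->|->]|->]; [left|right|].
have := sub d (or_introl (or_introl erefl)).
have := sub e (or_introl (or_intror erefl)).
have := sub f (or_intror erefl).
move: de df ef => /eqP de /eqP df /eqP ef.
by do 3![case=> ?]; congruence.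
Qed.

Lemma triple_opp a b c : root_triple Phi [set a; b; c] ->
  root_triple Phi [set - a; - b; - c].
Proof.
move=> [sub [a' [b' [c' [eqT [ab ac bc] [x [y [z [x0 y0 z0 abc]]]]]]]]].
split=> [t [[->|->]|->]|].
- by apply: root_opp => //; apply: sub; left; left.
- by apply: root_opp => //; apply: sub; left; right.
- by apply: root_opp => //; apply: sub; right.
exists (- a'), (- b'), (- c'); split.
- have oppT d e g : [set - d; - e; - g] = [set t | [set d; e; g] (- t)].
    apply/seteqP; split=> [t [[->|->]|->]|t [[|]|]] /=; rewrite ?opprK.
    + by left; left.
    + by left; right.
    + by right.
    + by move=> <-; rewrite opprK; left; left.
    + by move=> <-; rewrite opprK; left; right.
    + by move=> <-; rewrite opprK; right.
  by rewrite !oppT eqT.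
- by rewrite !(inj_eq oppr_inj).
exists x, y, z; split=> //.
by rewrite !scalerN -!opprD abc oppr0.
Qed.

Lemma triple_inversions a b c w : root_triple Phi [set a; b; c] -> W w ->
  inv w a -> inv w b -> inv w c -> False.
Proof.
by move=> tr Ww wa wb wc; apply: (triple_not_inversions tr Ww) => t [[->|->]|->].
Qed.

Lemma triple_root a b c : root_triple Phi [set a; b; c] ->
  [/\ Phi a, Phi b & Phi c].
Proof.
by move=> [sub _]; split; apply: sub; [left; left|left; right|right].
Qed.

Definition pos_closed (S : set 'cV[R]_n) := forall a b s t,
  S a -> S b -> 0 < s -> 0 < t -> Phi (s *: a + t *: b) ->
  S (s *: a + t *: b).

(** If [S] misses an inversion of [w] then it misses a root that is simple for
    the chamber of [w], since the simple ones generate all inversions under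
    positive combinations; crossing that wall changes [inv w] in one root. *)
Lemma inversions_adjacent (S : set 'cV[R]_n) w g : W w -> pos_closed S ->
  inv w g -> ~ S g ->
  exists d x, [/\ inv w d, ~ S d, W x &
    forall a, inv x a <-> a = - d \/ (inv w a /\ a <> d)].
Proof.
move=> Ww Scl wg nSg; pose m := - (w *m l).
have regm : regular (Phi := Phi) m by exact: (regular_chamber Ww).
have [d sd nSd] : exists2 d, simple (Phi := Phi) m d & ~ S d.
  apply: contrapT => no.
  have allS d : simple (Phi := Phi) m d -> S d.
    by move=> sd; apply: contrapT => nSd; apply: no; exists d.
  apply: nSg; have [] := (inversionsP g Ww).1 wg.
  move: g {wg}; apply: (simple_root_ind rootPhi regm) => // a d Pa sd ad Sda.
  have [Pd _ _] := sd; have dd := dot_gt0 (root_neq0 rootPhi Pd).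
  have defa : a = 1 *: (refl d *m a) + (2 * dot d a / dot d d) *: d.
    by rewrite scale1r reflE subrK.
  rewrite defa; apply: Scl => //; [exact: allS| |by rewrite -defa].
  by rewrite divr_gt0// mulr_gt0// dotC.
have [Pd md posd] := sd; have d_neq0 := root_neq0 rootPhi Pd.
have wd : inv w d by apply/inversionsP.
have Wx : W (refl d *m w) by apply: coxeter_mul => //; exact: coxeter_refl.
exists d, (refl d *m w); split=> // a.
have xE : inv (refl d *m w) a <-> Phi a /\ 0 < dot m (refl d *m a).
  rewrite inversionsP// /m -mulmxA dotNl dot_mulmxl trmx_refl dotNl.
  by [].
rewrite xE; split=> [[Pa ma]|].
  have [->|ad] := pselect (a = - d); [by left|right].
  have mRa : 0 < dot m a.
    have := posd (refl d *m a) _ ma; rewrite mulmxA reflK// mul1mx; apply.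
      exact/(root_refl rootPhi).
    move=> /(congr1 (mulmx (refl d))).
    by rewrite mulmxA reflK// mul1mx refl_self.
  split=> [|ad']; first exact/inversionsP.
  by move: ma; rewrite ad' refl_self// dotNr; lra.
move=> [->|[/(inversionsP _ Ww)[Pa ma] ad]]; last by split=> //; exact: posd.
by split; [exact: root_opp|rewrite mulmxN refl_self// opprK].
Qed.

(** * Condorcet domains *)

Lemma condorcet_coxeter D w : condorcet_domain Phi Phip D -> D w -> W w.
Proof. by move=> [_ sub _]; exact: sub. Qed.

(** Two equal elements among [p], [q], [r] would invert the whole triple, so
    they are distinct. *)
Lemma condorcet_pairs D p q r a b c : condorcet_domain Phi Phip D ->
  root_triple Phi [set a; b; c] -> D p -> D q -> D r ->
  inv p a -> inv p b -> inv q a -> inv q c -> inv r b -> inv r c -> False.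
Proof.
move=> cD tr Dp Dq Dr pa pb qa qc rb rc.
have three w (Dw : D w) := triple_inversions tr (condorcet_coxeter cD Dw).
case: cD => _ _; apply; exists p, q, r, a, b, c; split=> //; split; apply/eqP.
- by move=> pq; apply: (three p) => //; rewrite pq.
- by move=> pr; apply: (three p) => //; rewrite pr.
- by move=> qr; apply: (three q) => //; rewrite qr.
Qed.

Section Preposet.

Context {D : set 'M[R]_n}.
Hypothesis cD : condorcet_domain Phi Phip D.

Let WD w : D w -> W w := @condorcet_coxeter D w cD.

Notation "a ≼ b" := (preposet Phi Phip D a b) (at level 70).

Lemma preposet_refl a : Phi a -> a ≼ a.
Proof. by split. Qed.

Lemma preposet_trans b a c : a ≼ b -> b ≼ c -> a ≼ c.
Proof. by move=> [Pa Pb ab] [_ Pc bc]; split=> // w /bc/ab. Qed.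

Lemma preposetP a b w : a ≼ b -> D w -> inv w b -> inv w a.
Proof. by move=> [_ _ ab] Dw wb; have [] : subdomain Phi Phip D a w by apply: ab. Qed.

Lemma preposet_opp a b : a ≼ b -> - b ≼ - a.
Proof.
move=> ab; have [Pa Pb _] := ab.
split=> [||w [Dw wa]]; [exact: root_opp|exact: root_opp|split=> //].
apply/inversions_opp => // [|wb]; first exact: WD.
have : inv w a by exact: preposetP ab _ _.
by apply/inversions_opp => //; exact: WD.
Qed.

(** * Connected domains are peak-pit *)

Lemma card_I1_uniq (T : Type) (A : set T) (a b : T) :
  (A #= `I_1)%card -> A a -> A b -> a = b.
Proof.
move=> /card_set_bijP[f [fsub finj _]] Aa Ab; apply: finj; rewrite ?inE//.
by move: (fsub _ Aa) (fsub _ Ab); rewrite /= !ltnS !leqn0 => /eqP -> /eqP ->.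
Qed.

Lemma connected_constant a b : Phi a -> b <> - a ->
    (forall w, D w -> inv w b <-> ~ inv w a) ->
    connected_domain Phi Phip D ->
  forall u v, D u -> D v -> inv u a -> inv v a.
Proof.
move=> Pa nab alt conn u v Du Dv.
have [m [w [<- <- Dw step]]] := conn u v Du Dv.
elim: m Dw step => // m IHm Dw step ua.
have {IHm}wa : inv (w m) a.
  by apply: IHm => // i im; [apply: Dw|apply: step]; exact: leqW.
have [D0 D1] : D (w m) /\ D (w m.+1) by split; apply: Dw.
apply: contrapT => wa'; apply: nab.
apply: (card_I1_uniq (step m (ltnSn m))).
- split; first exact/(alt _ D1).
  by move=> /(alt _ D0); apply.
- split; first by apply/inversions_opp => //; exact: WD.
  by move=> /inversions_opp; apply => //; exact: WD.
Qed.

Lemma triple_some a b c w : root_triple Phi [set a; b; c] -> D w ->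
  ~ inv w a -> ~ inv w b -> ~ inv w c -> False.
Proof.
move=> tr Dw na nb nc; have [Pa Pb Pc] := triple_root tr.
by apply: (triple_inversions (triple_opp tr) (WD Dw)); apply/inversions_opp;
  rewrite //; exact: WD.
Qed.

Lemma condorcet_singles p q r a b c : root_triple Phi [set a; b; c] ->
  D p -> D q -> D r ->
  ~ inv p a -> ~ inv p b -> ~ inv q a -> ~ inv q c -> ~ inv r b -> ~ inv r c ->
  False.
Proof.
move=> tr Dp Dq Dr pa pb qa qc rb rc; have [Pa Pb Pc] := triple_root tr.
by apply: (condorcet_pairs cD (triple_opp tr) Dp Dq Dr); apply/inversions_opp;
  rewrite //; exact: WD.
Qed.

(** The two relations required of a labelled triple say that the traces [{a, c}]
    and [{a}] of inversion sets do not occur; these traces are adjacent in the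
    hexagon of the six possible ones. *)
Lemma preposet_labelling a b c : root_triple Phi [set a; b; c] ->
    (forall w, D w -> inv w a -> inv w c -> False) ->
    (forall w, D w -> inv w a -> ~ inv w b -> ~ inv w c -> False) ->
  - c ≼ a /\ b ≼ - c.
Proof.
move=> tr no_ac no_a; have [Pa Pb Pc] := triple_root tr.
split; split=> //; try exact: root_opp.
  move=> w [Dw wa]; split=> //; apply/inversions_opp => //; first exact: WD.
  by move=> wc; exact: (no_ac w).
move=> w [Dw /inversions_opp wc]; split=> //; apply: contrapT => wb.
have {}wc : ~ inv w c by apply: wc => //; exact: WD.
apply: (no_a w) => //; apply: contrapT => wa.
exact: (triple_some tr Dw).
Qed.

Lemma set3_swap12 T (a b c : T) : [set a; b; c] = [set b; a; c].
Proof. by rewrite [X in X `|` _]setUC. Qed.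

Lemma set3_swap23 T (a b c : T) : [set a; b; c] = [set a; c; b].
Proof. by rewrite setUAC. Qed.

(** If the trace [{a}] or [{b}] does not occur either, it is adjacent to
    [{a, b}]. If both occur then [{c}] does not, by the Condorcet condition, so
    every element of [D] inverts exactly one of [a] and [b]; no wall crossing
    exchanges these two roots, which contradicts connectedness. *)
Lemma connected_triple a b c : connected_domain Phi Phip D ->
    root_triple Phi [set a; b; c] ->
    (forall w, D w -> inv w a -> inv w b -> False) ->
  exists d e f, [/\ [set a; b; c] = [set d; e; f], - f ≼ d & e ≼ - f].
Proof.
move=> conn tr no_ab; have [Pa Pb Pc] := triple_root tr.
have [only_a|no_a] :=
    pselect (exists w, [/\ D w, inv w a, ~ inv w b & ~ inv w c]); last first.
  have [] : - b ≼ a /\ c ≼ - b.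
    apply: preposet_labelling; [by rewrite -set3_swap23|exact: no_ab|].
    by move=> w Dw wa wc wb; apply: no_a; exists w.
  by exists a, c, b; split=> //; rewrite set3_swap23.
have [only_b|no_b] :=
    pselect (exists w, [/\ D w, inv w b, ~ inv w a & ~ inv w c]); last first.
  have [] : - a ≼ b /\ c ≼ - a.
    apply: preposet_labelling.
    - by rewrite -set3_swap23 -set3_swap12.
    - by move=> w Dw wb wa; exact: (no_ab w).
    - by move=> w Dw wb wc wa; apply: no_b; exists w.
  by exists b, c, a; split=> //; rewrite set3_swap12 set3_swap23.
have [u [Du ua ub uc]] := only_a; have [v [Dv vb va vc]] := only_b.
case: (va); apply: (connected_constant Pa (triple_neq_opp tr) _ conn Du Dv) => //.
move=> w Dw; split=> [wb wa|wa]; first exact: (no_ab w).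
by apply: contrapT => wb; exact: (condorcet_singles tr Dw Dv Du).
Qed.

Lemma connected_peak_pit : connected_domain Phi Phip D -> peak_pit Phi Phip D.
Proof.
move=> conn T tr; have [_ [a [b [c [defT _ _]]]]] := tr; subst T.
have [[p [Dp pa pb]]|no_ab] := pselect (exists w, [/\ D w, inv w a & inv w b]);
    last first.
  by apply: connected_triple => // w Dw wa wb; apply: no_ab; exists w.
have [[q [Dq qa qc]]|no_ac] := pselect (exists w, [/\ D w, inv w a & inv w c]);
    last first.
  rewrite set3_swap23 in tr *.
  by apply: connected_triple => // w Dw wa wc; apply: no_ac; exists w.
rewrite set3_swap12 set3_swap23 in tr *.
apply: connected_triple => // r Dr rb rc.
rewrite -set3_swap23 -set3_swap12 in tr.
exact: (condorcet_pairs cD tr Dp Dq Dr).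
Qed.

(** * Maximal peak-pit domains are connected *)

(** If [g = s a + t b] is a root outside [S] then [a], [b] and [- g] form a
    triple inside [S]. For the labelling [d, e, f] that peak-pit provides,
    [- f ≼ d] then puts [- f] into [S] along with [f]. *)
Lemma ideal_pos_closed (S : set 'cV[R]_n) : peak_pit Phi Phip D ->
    S `<=` Phi -> (forall a, Phi a -> S (- a) <-> ~ S a) ->
    (forall a b, a ≼ b -> S b -> S a) ->
  pos_closed S.
Proof.
move=> pp subS halfS idealS a b s t Sa Sb s0 t0 Pg.
apply: contrapT => nSg; have [Pa Pb] := (subS _ Sa, subS _ Sb).
set g := _ + _ in Pg nSg; have SNg : S (- g) by exact/halfS.
have colinear k d : S d -> 0 < k -> g <> k *: d.
  move=> Sd k0 gd; have Pd := subS _ Sd.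
  have : Phi (k *: d) by rewrite -gd.
  case/(root_colinear rootPhi Pd) => kd; first by apply: nSg; rewrite gd kd.
  have /eqP : (k + 1) *: d = 0 by rewrite scalerDl kd scale1r addNr.
  rewrite scaler_eq0 (negPf (root_neq0 rootPhi Pd)) orbF gt_eqF//; lra.
have notN d e : S d -> S e -> d <> - e.
  by move=> Sd Se de; apply: (halfS e (subS _ Se)).1 Se; rewrite -de.
have ab : a != b.
  apply/eqP => ab; apply: (colinear (s + t) a) => //; first by rewrite addr_gt0.
  by rewrite scalerDl {2}ab.
have notNg d e s' t' : S d -> S e -> 0 < s' -> 0 < t' ->
    g = s' *: d + t' *: e -> d != - g.
  move=> Sd Se s0' t0' defg; apply/eqP => dg; have Pd := subS _ Sd.
  have s1 : 0 < 1 + s' by rewrite addr_gt0.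
  apply: (colinear (t' / (1 + s')) e) => //; first exact: divr_gt0.
  apply: (scalerI (lt0r_neq0 s1)); rewrite scalerA mulrC divfK ?gt_eqF//.
  by rewrite scalerDl scale1r {1}defg dg scalerN addrAC addNr add0r.
have tr : root_triple Phi [set a; b; - g].
  split=> [t' [[->|->]|->] //|]; first exact: root_opp.
  exists a, b, (- g); split=> //.
    split=> //; first exact: (notNg _ _ _ _ Sa Sb s0 t0).
    by apply: (notNg _ _ _ _ Sb Sa t0 s0); rewrite addrC.
  by exists s, t, 1; split=> //; rewrite scale1r subrr.
have [d [e [f [eqT df ef]]]] := pp _ tr.
have inS k : [set d; e; f] k -> S k by rewrite -eqT => -[[->|->]|->].
have [Sd Sf] : S d /\ S f by split; apply: inS; [left; left|right].
by apply: (notN (- f) f) => //; exact: idealS df Sd.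
Qed.

(** Crossing the wall of [d] from [u] to [x] creates a two-element trace only on
    a triple [{d, b, c}], where the trace changes, up to exchanging [b] and
    [c], from [{b}] to [{d, b}]. If this violated the Condorcet condition then
    [{d, c}] and [{b, c}] would occur in [D]; the only labelling that peak-pit
    then allows gives [c ≼ d], whence [d ≼ c] by the minimality of [d], against
    the trace [{b, c}]. *)
Lemma peak_pit_adjacent u x d : peak_pit Phi Phip D -> D u -> W x -> ~ inv u d ->
    (forall a, inv x a <-> a = d \/ (inv u a /\ a <> - d)) ->
    (forall c, c ≼ d -> ~ inv u c -> d ≼ c) ->
  condorcet_domain Phi Phip (D `|` [set x]).
Proof.
move=> pp Du Wx ud xE mind.
have no_d b c q r : root_triple Phi [set d; b; c] -> D q -> D r -> inv x b ->
    inv q d -> inv q c -> inv r b -> inv r c -> False.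
  move=> tr Dq Dr xb qd qc rb rc; have [Pd Pb Pc] := triple_root tr.
  have not3 w : W w -> inv w d -> inv w b -> inv w c -> False.
    exact: triple_inversions.
  have xd : inv x d by apply/xE; left.
  have bd : b <> d by move=> bd; apply: (not3 r) => //; [exact: WD|rewrite -bd].
  have ub : inv u b by move/xE: xb => [//|[]].
  have uc : ~ inv u c.
    move=> uc; apply: (not3 x) => //; apply/xE; right; split=> // cd.
    by move: qc; rewrite cd; apply/inversions_opp => //; exact: WD.
  have cb : c <> b by move=> cb; apply: uc; rewrite cb.
  have cd : c <> d by move=> cd; apply: (not3 r) => //; [exact: WD|rewrite -cd].
  have {cd}cd : c ≼ d.
    have [a' [b' [c' [eqT ac bc]]]] := pp _ tr.
    have [_ _ Pc'] : [/\ Phi a', Phi b' & Phi c'].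
      by apply: triple_root; rewrite -eqT.
    have no_ac w : D w -> inv w a' -> inv w c' -> False.
      by move=> Dw wa; apply/inversions_opp => //; [exact: WD|exact: preposetP ac _ _].
    have no_a w : D w -> ~ inv w b' -> ~ inv w c' -> False.
      move=> Dw wb wc; apply: wb; apply: (preposetP bc Dw).
      by apply/inversions_opp => //; exact: WD.
    have inT k : [set a'; b'; c'] k -> [\/ k = d, k = b | k = c].
      by rewrite -eqT => -[[->|->]|->]; [apply: Or31|apply: Or32|apply: Or33].
    have cT : [set a'; b'; c'] c by rewrite -eqT; right.
    (* The traces [{a', c'}] and [{a'}] do not occur whereas [{b}], [{d, c}] and
       [{b, c}] do; this leaves [a' = d], [c' = b] and [b' = c]. *)
    case: (inT a' (or_introl (or_introl erefl))) => a'E;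
      case: (inT c' (or_intror erefl)) => c'E; subst a' c'; try by
        [case: (no_ac q)|case: (no_ac r)|case: (no_ac u)].
      by case: cT => [[|]|] // <- in bc *; exact: preposet_trans bc ac.
    case: (inT b' (or_introl (or_intror erefl))) => b'E; subst b'.
    - by case: (no_a u).
    - by case: cT => [[|]|].
    - by case: (no_a u).
  have dc := mind c cd uc.
  by apply: (not3 r) => //; [exact: WD|exact: preposetP dc Dr rc].
have no_x a b c q r : root_triple Phi [set a; b; c] -> D q -> D r ->
    inv x a -> inv x b -> inv q a -> inv q c -> inv r b -> inv r c -> False.
  move=> tr Dq Dr xa xb qa qc rb rc.
  have /xE[ad|[ua _]] := xa; first by subst a; exact: (no_d b c q r).
  have /xE[bd|[ub _]] := xb; last exact: (condorcet_pairs cD tr Du Dq Dr).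
  by subst b; rewrite set3_swap12 in tr; exact: (no_d a c r q).
have [neD subD _] := cD; split.
- by case: neD => w Dw; exists w; left.
- by move=> w [/subD//|->].
move=> [p [q [r [a [b [c [[Dp Dq Dr] [pq pr qr] tr [[pa pb] [qa qc] [rb rc]]]]]]]]].
have inD w : w != x -> (D `|` [set x]) w -> D w by move=> /eqP wx [].
have [px|px] := eqVneq p x.
  subst p; apply: (no_x a b c q r) => //; apply: inD => //; by rewrite eq_sym.
have [qx|qx] := eqVneq q x.
  subst q; rewrite set3_swap23 in tr; apply: (no_x a c b p r) => //; apply: inD => //.
  by rewrite eq_sym.
have [rx|rx] := eqVneq r x.
  subst r; rewrite set3_swap12 set3_swap23 in tr.
  by apply: (no_x b c a p q) => //; apply: inD.
by apply: (condorcet_pairs cD tr (inD _ px Dp) (inD _ qx Dq) (inD _ rx Dr)).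
Qed.

Lemma minimal_separating_root u v : D u -> D v -> u <> v ->
  exists d, [/\ inv v d, ~ inv u d &
    forall c, c ≼ d -> ~ inv u c -> d ≼ c].
Proof.
move=> Du Dv uv.
have [d0 [vd0 ud0]] : exists d, inv v d /\ ~ inv u d.
  apply: contrapT => no; apply: uv; apply: inversions_inj; try exact: WD.
  have sub a : inv v a -> inv u a.
    by move=> va; apply: contrapT => ua; apply: no; exists a.
  apply/seteqP; split=> // a ua; apply: contrapT => va.
  have Pa := inversions_root ua.
  have /sub : inv v (- a) by apply/inversions_opp => //; exact: WD.
  by move/inversions_opp; apply => //; exact: WD.
apply: contrapT => nomin.
pose lt a b := a ≼ b /\ ~ b ≼ a.
suff : forall a, Phi a -> ~ (inv v a /\ ~ inv u a).
  by move/(_ d0 (inversions_root vd0)); apply.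
apply: (@finite_set_ind _ _ (root_finite rootPhi) lt) => [a|a b c|a Pa IHa [va ua]].
- by case.
- move=> [ab nba] [bc ncb]; split; first exact: preposet_trans ab bc.
  by move=> ca; apply: ncb; exact: preposet_trans ca ab.
apply: nomin; exists a; split=> // c ca uc; apply: contrapT => ac.
apply: (IHa c) => //; first by have [] := ca.
by split=> //; exact: preposetP ca Dv va.
Qed.

(** Let [d0] be minimal among the roots that separate [v] from [u]. Switching
    in [inv u] the signs of all roots below [d0] produces an ideal, which is
    closed by [ideal_pos_closed], so that a wall of the chamber [u] belongs to
    one of the switched roots [d]; the latter is as minimal as [d0]. *)
Lemma peak_pit_step u v : peak_pit Phi Phip D -> D u -> D v -> u <> v ->
  exists d x, [/\ inv v d, ~ inv u d,
    forall a, inv x a <-> a = d \/ (inv u a /\ a <> - d) &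
    condorcet_domain Phi Phip (D `|` [set x])].
Proof.
move=> pp Du Dv uv; have [Wu Wv] := (WD Du, WD Dv).
have [d0 [vd0 ud0 mind0]] := minimal_separating_root Du Dv uv.
have Pd0 := inversions_root vd0.
have below a : a ≼ d0 -> inv v a by move=> ad; exact: preposetP ad Dv vd0.
pose S : set 'cV[R]_n :=
  [set a | Phi a /\ (a ≼ d0 \/ (inv u a /\ ~ - a ≼ d0))].
have not_both a : a ≼ d0 -> ~ - a ≼ d0.
  move=> ad Nad; have Pa := inversions_root (below a ad).
  by have /inversions_opp := below _ Nad; apply => //; exact: below.
have Scl : pos_closed S.
  apply: ideal_pos_closed => // [a [] //|a Pa|a b ab].
    have PNa := root_opp rootPhi Pa.
    split=> [[_ Na] [_ pa]|nSa].
      case: Na pa => [Na|[/inversions_opp Na]]; rewrite ?opprK => //.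
        by case=> [/not_both//|[_]]; apply.
      move=> nad [//|[ua _]]; exact: Na.
    split=> //; have [Nad|Nad] := pselect (- a ≼ d0); [by left|right].
    have nad : ~ a ≼ d0 by move=> ad; apply: nSa; split=> //; left.
    rewrite opprK; split=> //; apply/inversions_opp => // ua.
    by apply: nSa; split=> //; right.
  have [Pa Pb _] := ab; move=> [_ [bd|[ub Nbd]]]; split=> //.
    by left; exact: preposet_trans ab bd.
  right; split; first exact: preposetP ab Du ub.
  by move=> Nad; apply: Nbd; exact: preposet_trans (preposet_opp ab) Nad.
have uNd0 : inv u (- d0) by exact/inversions_opp.
have nSd0 : ~ S (- d0).
  have dd0 := preposet_refl Pd0.
  by move=> [_ [/(not_both _ dd0)//|[_]]]; rewrite opprK; apply.
have [e [x [ue nSe Wx xE]]] := inversions_adjacent Wu Scl uNd0 nSd0.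
have Pe := inversions_root ue.
have ed0 : - e ≼ d0.
  by apply: contrapT => Ned; apply: nSe; split=> //; right.
have ve := below _ ed0; have uNe : ~ inv u (- e) by move/inversions_opp; apply.
exists (- e), x; split=> //; first by move=> a; rewrite opprK.
apply: (@peak_pit_adjacent u x (- e)) => // [a|c ce uc]; first by rewrite opprK.
exact: preposet_trans ed0 (mind0 c (preposet_trans ce ed0) uc).
Qed.

Lemma maximal_peak_pit_connected :
    (~ exists D', condorcet_domain Phi Phip D' /\ D `<` D') ->
  peak_pit Phi Phip D -> connected_domain Phi Phip D.
Proof.
move=> maxD pp u v Du Dv.
(* Induction on the set of walls that separate [u] from [v]. *)
have [rk rk_lt] := finite_set_rank (root_finite rootPhi).
have [k] := ubnP (rk (inv v `\` inv u)); elim: k u Du => // k IHk u Du lt_k.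
have [->|uv] := pselect (u = v).
  by exists 0%N, (fun=> v); split.
have [d [x [vd ud xE cDx]]] := peak_pit_step pp Du Dv uv.
have Pd := inversions_root vd.
have Dx : D x.
  apply: contrapT => nDx; apply: maxD; exists (D `|` [set x]); split=> //.
  by split=> [w Dw|sub]; [left|apply: nDx; apply: sub; right].
have xd : inv x d by apply/xE; left.
have [|m [w [w0 wm Dw step]]] := IHk x Dx.
  rewrite ltnS in lt_k; apply: leq_trans lt_k; apply: (rk_lt _ _ _ d) => //.
    move=> a [va xa]; split=> // ua; apply: xa; apply/xE; right; split=> // ad.
    by move: va; rewrite ad; apply/inversions_opp => //; exact: WD.
  by case.
exists m.+1, (fun i => if i is j.+1 then w j else u); split=> // [[|i]|[|i]] //.
- exact: Dw.
- move=> _; rewrite /= w0.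
  suff -> : inv x `\` inv u = [set d] by exact: card_set1.
  apply/seteqP; split=> [a [/xE[//|[]] //]|a ->].
  by split.
- exact: step.
Qed.

End Preposet.
End Inversions.

Theorem theorem1p8 (R : realType) (n : nat) (Phi Phip : set 'cV[R]_n)
    (hPhi : root_system Phi) (hPhip : positive_system Phi Phip)
    (D : set 'M[R]_n) (hD : maximal_condorcet_domain Phi Phip D) :
  connected_domain Phi Phip D <-> peak_pit Phi Phip D.
Proof.
have [l [reg defPhip]] := hPhip; subst Phip; have [cD maxD] := hD.
split; first exact: (connected_peak_pit hPhi reg cD).
exact: (maximal_peak_pit_connected hPhi reg cD maxD).
Qed.
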